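(* Let $G\subset \mathrm{GL}(n)$ be a matrix Lie group with Lie algebra $\mathfrak g\subset\mathbb R^{n\times n}$, and let $(g(t),\xi(t))\in G\times\mathfrak g$, $0\le t<\infty$, be an arbitrary trajectory of $\dot g=g\xi$. Assume: (1) $A(t)=F g(t)$ for all $t\ge 0$, where $F\in\mathbb R^{n\times n}$ is a constant invertible matrix; (2) $\xi_{\rm m}(t)=\xi(t)+b$ for all $t\ge0$, where $b\in\mathfrak g$ is constant; (3) there are constants $B_\xi>0$, $B_b>0$ with $\|\xi(t)\|\le B_\xi$ for all $t\ge 0$ and $\|b\|\le B_b$, and there are numbers $L_g>0$, $U_g>0$ with $L_g\le\sigma_{\min}(g(t))\le\sigma_{\max}(g(t))\le U_g$ for all $t\ge0$. Consider the observer with state $(\bar A,\bar b)\in\mathbb R^{n\times n}\times\mathfrak g$ given by $$\dot{\bar A}=\bar A\,\xi_{\rm m}-A\bar b+k_P(A-\bar A),\qquad \dot{\bar b}=-k_I\,\pi_{\mathfrak g}\big(A^T(A-\bar A)\big),$$ and let $E_A=A-\bar A$, $e_b=b-\bar b$. Then for any $k_P>B_\xi+B_b$ and $k_I>0$ there exist numbers $a>0$ and $C>0$ such that $$\|E_A(t)\|+\|e_b(t)\|\le C\big(\|E_A(0)\|+\|e_b(0)\|\big)e^{-at}$$ for all $t\ge0$ and all initial conditions $(\bar A(0),\bar b(0))\in\mathbb R^{n\times n}\times\mathfrak g$ (with $a$, $C$ not depending on the initial condition).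
   Context: $\mathrm{GL}(n)=\{A\in\mathbb R^{n\times n}\mid\det A\ne0\}$; the Lie algebra $\mathfrak g$ of $G$ is regarded as a Lie subalgebra of $\mathbb R^{n\times n}$ with the matrix commutator. $\langle A,B\rangle=\operatorname{tr}(A^TB)$ is the Euclidean inner product on $\mathbb R^{n\times n}$, and $\|A\|=\sqrt{\langle A,A\rangle}$ is the Frobenius norm. $\pi_{\mathfrak g}:\mathbb R^{n\times n}\to\mathfrak g$ is the orthogonal projection onto $\mathfrak g$ with respect to $\langle\cdot,\cdot\rangle$. $\sigma_{\min}(\cdot)$ and $\sigma_{\max}(\cdot)$ denote the minimum and maximum singular values. *)

(* Defs.v *)
From HB Require Import structures.
From mathcomp Require Import all_boot all_order all_algebra.
From mathcomp Require Import all_classical all_reals all_analysis.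

Set Implicit Arguments.
Unset Strict Implicit.
Unset Printing Implicit Defensive.

Import Order.TTheory GRing.Theory Num.Theory.
Import numFieldNormedType.Exports.

Local Open Scope classical_set_scope.
Local Open Scope ring_scope.

(* The library norm `|A| on matrices is the max norm; it is used below only
   through the topology of 'M[R]_n. *)

Definition frob_inner (R : realType) (n : nat) (A B : 'M[R]_n) : R :=
  \tr (A^T *m B).

Definition frob_norm (R : realType) (n : nat) (A : 'M[R]_n) : R :=
  Num.sqrt (frob_inner A A).

(* The singular values of A are the square roots of the eigenvalues of A^T A.
   For n > 0 they form a nonempty finite set, so the inf and sup below are
   its minimum and maximum. *)
Definition singular_values (R : realType) (n : nat) (A : 'M[R]_n) : set R :=
  [set s | 0 <= s /\ eigenvalue (A^T *m A) (s ^+ 2)].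

Definition sigma_min (R : realType) (n : nat) (A : 'M[R]_n) : R :=
  inf (singular_values A).

Definition sigma_max (R : realType) (n : nat) (A : 'M[R]_n) : R :=
  sup (singular_values A).

Definition GLn (R : realType) (n : nat) : set 'M[R]_n :=
  [set A | \det A != 0].

(* A subgroup of GL(n) that is closed in GL(n) (not necessarily in 'M[R]_n). *)
Record matrix_lie_group (R : realType) (n : nat) (G : set 'M[R]_n) : Prop :=
  MatrixLieGroup {
    mlg_sub_GL : G `<=` @GLn R n;
    mlg_one : G 1%:M;
    mlg_mul : forall A B, G A -> G B -> G (A *m B);
    mlg_inv : forall A, G A -> G (invmx A);
    mlg_closed : closure G `&` @GLn R n `<=` G }.

(* The tangent space of G at the identity: velocities at 0 of the smooth
   curves ]-e, e[ -> G passing through 1%:M at 0. *)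
Definition lie_algebra (R : realType) (n : nat) (G : set 'M[R]_n) :
    set 'M[R]_n :=
  [set X | exists (c : R -> 'M[R]_n) (e : R),
    [/\ 0 < e,
        c 0 = 1%:M,
        forall t : R, `|t| < e -> G (c t) /\ forall k : nat, derivable (derive1n k c) t 1
      & derive1 c 0 = X]].

(* xget selects the P in V with A - P orthogonal to V; it exists and is unique
   when V is a linear subspace. *)
Definition orthoproj (R : realType) (n : nat) (V : set 'M[R]_n)
    (A : 'M[R]_n) : 'M[R]_n :=
  xget 0 [set P | V P /\ forall B, V B -> frob_inner (A - P) B = 0].

(* f' = df on the half-line [0, +oo[: a two-sided derivative at t > 0, and the
   right derivative at t = 0.  Values at negative times are irrelevant. *)
Definition deriv_halfline (R : realType) (n : nat) (f df : R -> 'M[R]_n) :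
    Prop :=
  forall t : R, 0 <= t ->
    ((s - t)^-1 *: (f s - f t)) @[s --> within `[0, +oo[ t^'] --> df t.

(* Main.v *)
Require Import Defs.
From HB Require Import structures.
From mathcomp Require Import all_boot all_order all_algebra.
From mathcomp Require Import all_classical all_reals all_analysis.
From mathcomp Require Import ring lra.

Set Implicit Arguments.
Unset Strict Implicit.
Unset Printing Implicit Defensive.

Import Order.TTheory GRing.Theory Num.Theory.
Import numFieldNormedType.Exports.

Local Open Scope classical_set_scope.
Local Open Scope ring_scope.

(** Write [E = A - Abar] and [e = b - bbar] for the errors. They satisfy
    [dE/dt = E (xi + b) - A e - kP E] and [de/dt = kI P], where [P] is the
    projection of [A^T E] onto the Lie algebra. As [e] lies in the Lie algebra,
    [<P, e> = <A^T E, e> = <E, A e>], so these terms cancel in the derivative of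
    [|E|^2 / 2 + |e|^2 / (2 kI)], which is at most
    [- (kP - B_xi - B_b) |E|^2]. This controls [E] but not [e].

    The remedy is to add the cross term [eps <E, A e>]. Its derivative contains
    [- eps |A e|^2 <= - eps al |e|^2], because the smallest singular value of
    [A = F g] stays away from zero, and its other terms are bounded by
    multiples of [eps |E| |e|] and [eps |E|^2]
    ([lyapunov_dissipation]). For [eps] small the sum [W] is comparable to
    [|E|^2 + |e|^2] and satisfies [dW/dt <= - (l / K) W] ([lyapunov_constants]), hence
    decays exponentially ([exponential_decay]), with constants that depend only
    on the bounds on the data.

    Three facts support this argument. Bounds on the singular values of [g]
    bound the action of [g] from both sides, which is read off the extrema of
    the Rayleigh quotient ([sigma_min_frob], [sigma_max_frob]). The Lie algebra,
    given as a set of velocities of curves, is a linear subspace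
    ([lie_algebra_subspace]), so that the projection exists ([orthoprojP]).
    Finally, solutions on the half-line extend to functions that are
    differentiable at [0] ([halfline_extension]). *)

(** * The Frobenius inner product *)

(** By Lagrange's identity, twice the difference of the two sides is the sum
    of the squares of all [a i * b j - a j * b i]. *)
Lemma sum_cauchy_schwarz (R : realType) (I : finType) (a b : I -> R) :
  (\sum_i a i * b i) ^+ 2 <= (\sum_i a i ^+ 2) * (\sum_i b i ^+ 2).
Proof.
have : 0 <= \sum_i \sum_j (a i * b j - a j * b i) ^+ 2.
  by apply: sumr_ge0 => i _; apply: sumr_ge0 => j _; exact: sqr_ge0.
have -> : \sum_i \sum_j (a i * b j - a j * b i) ^+ 2 =
  \sum_i \sum_j a i ^+ 2 * b j ^+ 2 + \sum_i \sum_j b i ^+ 2 * a j ^+ 2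
    - 2 * \sum_i \sum_j (a i * b i) * (a j * b j).
  rewrite mulr_sumr -big_split -sumrB/=; apply: eq_bigr => i _.
  rewrite mulr_sumr -big_split -sumrB/=; apply: eq_bigr => j _.
  ring.
have dist (u v : I -> R) :
    \sum_i \sum_j u i * v j = (\sum_i u i) * (\sum_j v j).
  by rewrite big_distrlr.
rewrite (dist (fun i => a i ^+ 2) (fun i => b i ^+ 2)).
rewrite (dist (fun i => b i ^+ 2) (fun i => a i ^+ 2)).
rewrite (dist (fun i => a i * b i) (fun i => a i * b i)).
set x := \sum_i _; set y := \sum_i _; set z := \sum_i _.
nra.
Qed.

Section Frobenius.
Context {R : realType} {n : nat}.
Implicit Types (A B X Y : 'M[R]_n) (c : R).

Lemma frob_innerE A B : frob_inner A B = \sum_i \sum_j A i j * B i j.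
Proof.
rewrite /frob_inner /mxtrace exchange_big/=; apply: eq_bigr => i _.
by rewrite mxE; apply: eq_bigr => j _; rewrite mxE.
Qed.

Lemma frob_innerC A B : frob_inner A B = frob_inner B A.
Proof. by rewrite /frob_inner -mxtrace_tr trmx_mul trmxK. Qed.

Lemma frob_innerDr A X Y :
  frob_inner A (X + Y) = frob_inner A X + frob_inner A Y.
Proof. by rewrite /frob_inner mulmxDr mxtraceD. Qed.

Lemma frob_innerNr A X : frob_inner A (- X) = - frob_inner A X.
Proof. by rewrite /frob_inner mulmxN raddfN. Qed.

Lemma frob_innerZr A c X : frob_inner A (c *: X) = c * frob_inner A X.
Proof. by rewrite /frob_inner -scalemxAr mxtraceZ. Qed.

Lemma frob_innerDl A X Y :
  frob_inner (X + Y) A = frob_inner X A + frob_inner Y A.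
Proof. by rewrite frob_innerC frob_innerDr !(frob_innerC A). Qed.

Lemma frob_innerNl A X : frob_inner (- X) A = - frob_inner X A.
Proof. by rewrite frob_innerC frob_innerNr frob_innerC. Qed.

Lemma frob_innerZl A c X : frob_inner (c *: X) A = c * frob_inner X A.
Proof. by rewrite frob_innerC frob_innerZr frob_innerC. Qed.

Lemma frob_inner_adj A X Y :
  frob_inner X (A *m Y) = frob_inner (A^T *m X) Y.
Proof. by rewrite /frob_inner trmx_mul trmxK mulmxA. Qed.

Lemma frob_inner_ge0 A : 0 <= frob_inner A A.
Proof.
rewrite frob_innerE; apply: sumr_ge0 => i _; apply: sumr_ge0 => j _.
exact: sqr_ge0.
Qed.

Lemma frob_inner_eq0 A : frob_inner A A = 0 -> A = 0.
Proof.
rewrite frob_innerE => /eqP; rewrite psumr_eq0; last first.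
  by move=> i _; apply: sumr_ge0 => j _; exact: sqr_ge0.
move=> /allP A0; apply/matrixP => i j; rewrite mxE.
have /eqP := implyP (A0 i (mem_index_enum _)) isT.
move/eqP; rewrite psumr_eq0; last by move=> k _; exact: sqr_ge0.
move/allP/(_ j (mem_index_enum _))/implyP/(_ isT).
by rewrite mulf_eq0 orbb => /eqP.
Qed.

Lemma frob_norm_ge0 A : 0 <= frob_norm A.
Proof. exact: sqrtr_ge0. Qed.

Lemma sqr_frob_norm A : frob_norm A ^+ 2 = frob_inner A A.
Proof. by rewrite sqr_sqrtr// frob_inner_ge0. Qed.

Lemma ler_frob_norm A c : 0 <= c -> frob_inner A A <= c ^+ 2 ->
  frob_norm A <= c.
Proof.
by move=> c0 h; rewrite -(@ler_pXn2r _ 2)// ?nnegrE ?frob_norm_ge0//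
  sqr_frob_norm.
Qed.

Lemma frob_norm_trmx A : frob_norm A^T = frob_norm A.
Proof. by rewrite /frob_norm /frob_inner trmxK mxtrace_mulC. Qed.

Lemma frob_normZ c A : frob_norm (c *: A) = `|c| * frob_norm A.
Proof.
by rewrite /frob_norm frob_innerZl frob_innerZr mulrA -expr2 sqrtrM ?sqr_ge0//
  sqrtr_sqr.
Qed.

Lemma frob_cauchy_schwarz A B :
  `|frob_inner A B| <= frob_norm A * frob_norm B.
Proof.
rewrite -(@ler_pXn2r _ 2)// ?nnegrE ?mulr_ge0 ?frob_norm_ge0//.
rewrite real_normK ?num_real// exprMn !sqr_frob_norm !frob_innerE !pair_bigA/=.
exact: (sum_cauchy_schwarz (fun p => A p.1 p.2) (fun p => B p.1 p.2)).
Qed.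

Lemma frob_normD A B : frob_norm (A + B) <= frob_norm A + frob_norm B.
Proof.
apply: ler_frob_norm; first by rewrite addr_ge0 ?frob_norm_ge0.
rewrite frob_innerDl !frob_innerDr (frob_innerC B A).
have := frob_cauchy_schwarz A B; rewrite ler_norml => /andP[_ h].
rewrite sqrrD !sqr_frob_norm; lra.
Qed.

Lemma frob_norm_mulmx A B : frob_norm (A *m B) <= frob_norm A * frob_norm B.
Proof.
apply: ler_frob_norm; first by rewrite mulr_ge0 ?frob_norm_ge0.
rewrite exprMn !sqr_frob_norm !frob_innerE.
rewrite [X in _ <= _ * X]exchange_big/= big_distrlr/=.
apply: ler_sum => i _; apply: ler_sum => j _; rewrite !mxE -expr2.
exact: (sum_cauchy_schwarz (fun k => A i k) (fun k => B k j)).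
Qed.

End Frobenius.

(** * Extreme singular values bound the action of a matrix *)

(** For [t] proportional to [x] and small, the linear term would win. *)
Lemma linear_coeff_eq0 (R : realType) (x y : R) : 0 <= y ->
  (forall t, 0 <= t ^+ 2 * y - 2 * t * x) -> x = 0.
Proof.
move=> y0 /(_ (x / (y + 1))) h.
have [t xt] : exists t, x = t * (y + 1).
  by exists (x / (y + 1)); rewrite divfK//; lra.
move: h; rewrite {}xt mulfK; last lra.
move=> h; have t2 : t ^+ 2 <= 0 by nra.
have : t ^+ 2 == 0 by rewrite eq_le t2 sqr_ge0.
by rewrite sqrf_eq0 => /eqP ->; rewrite mul0r.
Qed.

(** Row vectors are used because [eigenvalue] refers to left
    eigenvectors. *)
Section Rayleigh.
Context {R : realType} {n : nat}.
Implicit Types (u v w : 'rV[R]_n) (S : 'M[R]_n) (c : R).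

Definition rdot u v : R := (u *m v^T) 0 0.

Lemma rdotE u v : rdot u v = \sum_j u 0 j * v 0 j.
Proof. by rewrite /rdot mxE; apply: eq_bigr => j _; rewrite mxE. Qed.

Lemma rdotC u v : rdot u v = rdot v u.
Proof. by rewrite !rdotE; apply: eq_bigr => j _; rewrite mulrC. Qed.

Lemma rdotDl u v w : rdot (u + v) w = rdot u w + rdot v w.
Proof. by rewrite /rdot mulmxDl mxE. Qed.

Lemma rdotNl u w : rdot (- u) w = - rdot u w.
Proof. by rewrite /rdot mulNmx mxE. Qed.

Lemma rdotZl c u w : rdot (c *: u) w = c * rdot u w.
Proof. by rewrite /rdot -scalemxAl mxE. Qed.

Lemma rdotDr u v w : rdot w (u + v) = rdot w u + rdot w v.
Proof. by rewrite rdotC rdotDl !(rdotC w). Qed.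

Lemma rdotNr u w : rdot w (- u) = - rdot w u.
Proof. by rewrite rdotC rdotNl rdotC. Qed.

Lemma rdotZr c u w : rdot w (c *: u) = c * rdot w u.
Proof. by rewrite rdotC rdotZl rdotC. Qed.

Lemma rdot_adj u v S : rdot (u *m S) v = rdot u (v *m S^T).
Proof. by rewrite /rdot trmx_mul trmxK mulmxA. Qed.

Lemma rdot_ge0 v : 0 <= rdot v v.
Proof. by rewrite rdotE; apply: sumr_ge0 => j _; exact: sqr_ge0. Qed.

Lemma rdot_eq0 v : rdot v v = 0 -> v = 0.
Proof.
rewrite rdotE => /eqP; rewrite psumr_eq0; last by move=> j _; exact: sqr_ge0.
move=> /allP v0; apply/rowP => j; rewrite mxE.
have := implyP (v0 j (mem_index_enum _)) isT.
by rewrite mulf_eq0 orbb => /eqP.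
Qed.

Lemma rdot_gt0 v : v != 0 -> 0 < rdot v v.
Proof. by rewrite lt0r rdot_ge0 andbT; apply: contra_neq; exact: rdot_eq0. Qed.

Lemma continuous_quadratic S : continuous (fun v => rdot (v *m S) v).
Proof.
move=> v; rewrite (_ : (fun v => _) = fun v : 'rV[R]_n =>
  \sum_j (\sum_i v 0 i * S i j) * v 0 j); last first.
  by apply/funext => w; rewrite rdotE; apply: eq_bigr => j _; rewrite mxE.
apply: continuous_big => [|j _].
  exact: add_continuous.
have row_cont : continuous (fun w : 'rV[R]_n => \sum_i w 0 i * S i j).
  apply: continuous_big => [|i _ w]; first exact: add_continuous.
  by apply: continuousM; [exact: coord_continuous|exact: cst_continuous].
by move=> w; apply: continuousM; [exact: row_cont|exact: coord_continuous].
Qed.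

Lemma compact_sphere : compact [set v | rdot v v = 1].
Proof.
apply: bounded_closed_compact.
  exists 1; split; first exact: num_real.
  move=> M M1 v /= v1; apply: le_trans (ltW M1).
  rewrite [leLHS]/Num.Def.normr/= mx_normrE.
  apply/bigmax_leP; split => // -[i j] _ /=; rewrite ord1.
  rewrite -(@ler_pXn2r _ 2)// ?nnegrE// real_normK ?num_real// expr1n -v1.
  rewrite rdotE (bigD1 j)//= -expr2 lerDl sumr_ge0// => k _.
  by rewrite -expr2 sqr_ge0.
rewrite (_ : [set v | _] = (fun v => rdot (v *m 1%:M) v) @^-1` [set 1]).
  have /continuous_closedP := @continuous_quadratic 1%:M.
  by apply; exact: closed_eq.
by apply/seteqP; split => v /=; rewrite mulmx1.
Qed.

(** A minimiser [v] of the quadratic form on the unit sphere is an eigenvector: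
    with [T := S - mu], the form of [T] is nonnegative and vanishes at [v], so
    its first variation at [v] vanishes, that is [v *m T = 0]. *)
Lemma rayleigh_min S : (0 < n)%N -> S^T = S ->
  exists mu v, [/\ v != 0, v *m S = mu *: v &
    forall w, mu * rdot w w <= rdot (w *m S) w].
Proof.
move=> n0 symS.
have [v /set_mem/= v1 vmin] : exists2 v, v \in [set v | rdot v v = 1] &
    forall w, w \in [set v | rdot v v = 1] ->
      rdot (v *m S) v <= rdot (w *m S) w.
  apply: EVT_min_rV.
  - exists (delta_mx 0 (Ordinal n0)) => /=; rewrite /rdot trmx_delta.
    by rewrite mul_delta_mx mxE !eqxx.
  - exact: compact_sphere.
  - exact/continuous_subspaceT/continuous_quadratic.
set mu := rdot (v *m S) v in vmin.
have minw w : mu * rdot w w <= rdot (w *m S) w.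
  have [->|w0] := eqVneq w 0; first by rewrite mul0mx /rdot mul0mx mxE mulr0.
  have ww := rdot_gt0 w0; pose s := Num.sqrt (rdot w w).
  have s0 : 0 < s by rewrite sqrtr_gt0.
  have s2 : s ^+ 2 = rdot w w by rewrite sqr_sqrtr ?rdot_ge0.
  have := vmin (s^-1 *: w); rewrite -scalemxAl !rdotZl !rdotZr !mulrA -expr2.
  rewrite exprVn s2 => h; rewrite -ler_pdivlMr// mulrC; apply: h.
  by rewrite inE /= !rdotZl !rdotZr mulrA -expr2 exprVn s2 mulVf// gt_eqF.
exists mu, v; split => //.
  by apply/eqP => v0; move: v1; rewrite v0 /rdot mul0mx mxE => /esym/eqP;
    rewrite oner_eq0.
pose T := S - mu%:M.
have TE w : w *m T = w *m S - mu *: w by rewrite mulmxBr mul_mx_scalar.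
have T0 w : 0 <= rdot (w *m T) w.
  by rewrite TE rdotDl rdotNl rdotZl subr_ge0.
have Tv : rdot (v *m T) v = 0 by rewrite TE rdotDl rdotNl rdotZl v1 mulr1 subrr.
have symT : T^T = T by rewrite /T linearB/= symS tr_scalar_mx.
suff /rdot_eq0 /eqP : rdot (v *m T) (v *m T) = 0.
  by rewrite TE subr_eq0 => /eqP.
set w := v *m T.
apply: (@linear_coeff_eq0 _ _ (rdot (w *m T) w)) => // t.
have := T0 (v - t *: w).
rewrite mulmxBl -scalemxAl -/w.
rewrite !(rdotDl, rdotNl, rdotZl, rdotDr, rdotNr, rdotZr) Tv.
have -> : rdot (w *m T) v = rdot w w by rewrite rdot_adj symT.
by congr (_ <= _); ring.
Qed.

Lemma rayleigh_max S : (0 < n)%N -> S^T = S ->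
  exists mu v, [/\ v != 0, v *m S = mu *: v &
    forall w, rdot (w *m S) w <= mu * rdot w w].
Proof.
move=> n0 symS; have symN : (- S)^T = - S by rewrite linearN/= symS.
have [mu [v [v0 vS min_w]]] := rayleigh_min n0 symN.
exists (- mu), v; split => // [|w].
  by rewrite scaleNr -vS mulmxN opprK.
by have := min_w w; rewrite mulmxN rdotNl mulNr; lra.
Qed.

End Rayleigh.

Section SingularValues.
Context {R : realType} {n : nat}.
Implicit Types (g X : 'M[R]_n) (v : 'rV[R]_n) (s : R).

Lemma gram_sym g : (g^T *m g)^T = g^T *m g.
Proof. by rewrite trmx_mul trmxK. Qed.

Lemma rdot_gram g v : rdot (v *m (g^T *m g)) v = rdot (v *m g^T) (v *m g^T).
Proof. by rewrite mulmxA rdot_adj. Qed.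

Lemma frob_inner_rdot X :
  frob_inner X X = \sum_j rdot (row j X^T) (row j X^T).
Proof.
rewrite /frob_inner /mxtrace; apply: eq_bigr => j _.
by rewrite mxE rdotE; apply: eq_bigr => k _; rewrite !mxE.
Qed.

Lemma gram_eigenvalue_ge0 g v mu :
  v != 0 -> v *m (g^T *m g) = mu *: v -> 0 <= mu.
Proof.
move=> v0 vg; have := rdot_ge0 (v *m g^T).
by rewrite -rdot_gram vg rdotZl pmulr_lge0// rdot_gt0.
Qed.

Lemma singular_value_sqrt g v mu :
  v != 0 -> v *m (g^T *m g) = mu *: v -> singular_values g (Num.sqrt mu).
Proof.
move=> v0 vg; split; first exact: sqrtr_ge0.
rewrite sqr_sqrtr ?(gram_eigenvalue_ge0 v0 vg)//.
by apply/eigenvalueP; exists v.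
Qed.

(** The square of the norm of [v *m g^T] is the quadratic form of the Gram matrix
    at [v]. Its minimum over the unit sphere is the square of a singular value,
    hence at least [sigma_min g ^+ 2]; the claim is the sum over the rows [v] of
    [X^T]. *)
Lemma sigma_min_frob g X : (0 < n)%N -> 0 <= sigma_min g ->
  sigma_min g ^+ 2 * frob_inner X X <= frob_inner (g *m X) (g *m X).
Proof.
move=> n0 s0; have [mu [v [v0 vg mu_le]]] := rayleigh_min n0 (gram_sym g).
have lb : has_lbound (singular_values g) by exists 0 => s [].
have mu0 := gram_eigenvalue_ge0 v0 vg.
have : sigma_min g <= Num.sqrt mu.
  exact: (ge_inf lb) (singular_value_sqrt v0 vg).
rewrite -(@ler_pXn2r _ 2)// ?nnegrE ?sqrtr_ge0// sqr_sqrtr// => le_mu.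
rewrite !frob_inner_rdot mulr_sumr; apply: ler_sum => j _.
rewrite trmx_mul row_mul -rdot_gram; apply: le_trans (mu_le _).
by rewrite ler_wpM2r ?rdot_ge0.
Qed.

(** Besides a singular value that dominates the quadratic form, the maximal
    Rayleigh quotient gives the upper bound on all singular values without which
    their [sup] would be the default value 0. *)
Lemma sigma_max_frob g X : (0 < n)%N ->
  frob_inner (g *m X) (g *m X) <= sigma_max g ^+ 2 * frob_inner X X.
Proof.
move=> n0; have [mu [v [v0 vg mu_ge]]] := rayleigh_max n0 (gram_sym g).
have mu0 := gram_eigenvalue_ge0 v0 vg.
have ub : has_ubound (singular_values g).
  exists (Num.sqrt mu) => s [s0 /eigenvalueP[w wg w0]].
  rewrite -(@ler_pXn2r _ 2)// ?nnegrE ?sqrtr_ge0// sqr_sqrtr//.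
  by have := mu_ge w; rewrite wg rdotZl ler_pM2r ?rdot_gt0.
have : Num.sqrt mu <= sigma_max g.
  exact: (ub_le_sup ub) (singular_value_sqrt v0 vg).
move=> le_s; have s0 := le_trans (sqrtr_ge0 mu) le_s; move: le_s.
rewrite -(@ler_pXn2r _ 2)// ?nnegrE ?sqrtr_ge0// sqr_sqrtr// => le_mu.
rewrite !frob_inner_rdot mulr_sumr; apply: ler_sum => j _.
rewrite trmx_mul row_mul -rdot_gram; apply: le_trans (mu_ge _) _.
by rewrite ler_wpM2r ?rdot_ge0.
Qed.

End SingularValues.

(** * Orthogonal projection onto a linear subspace of matrices *)

Section Projection.
Context {R : realType} {n : nat}.
Implicit Types (V : set 'M[R]_n) (A B X : 'M[R]_n).

Record linear_subspace V : Prop := LinearSubspace {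
  subspace0 : V 0;
  subspaceD : forall A B, V A -> V B -> V (A + B);
  subspaceZ : forall c A, V A -> V (c *: A) }.

Definition orthonormal_in V k (e : 'I_k -> 'M[R]_n) : Prop :=
  (forall i, V (e i)) /\ forall i j, frob_inner (e i) (e j) = (i == j)%:R.

Lemma frob_inner_mxvec A B : frob_inner A B = (mxvec A *m (mxvec B)^T) 0 0.
Proof.
rewrite frob_innerE pair_bigA mxE.
rewrite (reindex _ (curry_mxvec_bij _ _))/=.
by apply: eq_bigr => -[i j] _; rewrite mxE !mxvecE.
Qed.

Lemma frob_inner_suml k (c : 'I_k -> R) (e : 'I_k -> 'M[R]_n) B :
  frob_inner (\sum_i c i *: e i) B = \sum_i c i * frob_inner (e i) B.
Proof.
elim/big_ind2: _ => [|x1 x2 y1 y2 <- <-|i _].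
- by rewrite frob_innerC -(scale0r (0 : 'M[R]_n)) frob_innerZr mul0r.
- by rewrite frob_innerDl.
- by rewrite frob_innerZl.
Qed.

(** The Gram matrix of the family is the identity, of rank [k], and factors
    through a space of dimension [n * n]. *)
Lemma orthonormal_leq V k (e : 'I_k -> 'M[R]_n) :
  orthonormal_in V e -> (k <= n * n)%N.
Proof.
move=> [_ orth]; pose M := \matrix_(i < k) mxvec (e i).
have MM : M *m M^T = 1%:M.
  apply/matrixP => i j; rewrite !mxE -orth frob_inner_mxvec mxE.
  by apply: eq_bigr => l _; rewrite !mxE.
by rewrite -[k in (k <= _)%N](@mxrank1 R) -MM
  (leq_trans (mxrankM_maxl _ _))// rank_leq_col.
Qed.

(** An orthonormal family of maximal size in [V] is a basis of [V]: otherwise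
    one more step of the Gram-Schmidt process would extend it. The projection
    is given by the coordinates in that basis. *)
Lemma exists_orthogonal_projection V A : linear_subspace V ->
  exists P, V P /\ forall B, V B -> frob_inner (A - P) B = 0.
Proof.
move=> [V0 VD VZ].
pose good k := `[< exists e : 'I_k -> 'M[R]_n, orthonormal_in V e >].
have ex_good : exists k, good k.
  by exists 0%N; apply/asboolP; exists (fun=> 0); split => -[].
have good_le k : good k -> (k <= n * n)%N.
  by move=> /asboolP[e /orthonormal_leq].
case: (ex_maxnP ex_good good_le) => k /asboolP[e [Ve orth]] kmax.
pose P X := \sum_i frob_inner X (e i) *: e i.
have VP X : V (P X).
  by rewrite /P; elim/big_ind: _ => // i _; exact: VZ.
have Pe X i : frob_inner (X - P X) (e i) = 0.
  rewrite frob_innerDl frob_innerNl frob_inner_suml (bigD1 i)//= orth eqxx mulr1.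
  rewrite big1 ?addr0 ?subrr// => j ji.
  by rewrite orth (negbTE ji) mulr0.
have PV B : V B -> B = P B.
  move=> VB; apply/eqP; rewrite -subr_eq0; apply/negP => D0.
  pose D := B - P B; pose d := frob_norm D.
  have De i : frob_inner D (e i) = 0 by exact: Pe.
  have DD : frob_inner D D != 0 by apply: contra_not_neq D0 => /frob_inner_eq0/eqP.
  have d0 : d != 0.
    by apply: contra_neq DD => d0; rewrite -sqr_frob_norm -/d d0 expr0n.
  have VDd : V (d^-1 *: D).
    by apply: (VZ); apply: VD => //; rewrite -scaleN1r; exact: VZ.
  suff : good k.+1 by move=> /kmax; rewrite ltnn.
  apply/asboolP.
  exists (fun i => if unlift ord_max i is Some j then e j else d^-1 *: D).
  split=> [i|i j]; first by case: unliftP.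
  case: unliftP => [i'|] ->; case: unliftP => [j'|] ->.
  - by rewrite orth (inj_eq lift_inj).
  - by rewrite frob_innerZr frob_innerC De mulr0 eq_sym
      (negbTE (neq_lift _ _)).
  - by rewrite frob_innerZl De mulr0 (negbTE (neq_lift _ _)).
  - rewrite eqxx frob_innerZl frob_innerZr mulrA -invfM -expr2 sqr_frob_norm.
    by rewrite mulVf.
exists (P A); split => // B VB.
rewrite (PV B VB) frob_innerC frob_inner_suml big1// => i _.
by rewrite (frob_innerC (e i)) Pe mulr0.
Qed.

Lemma orthoprojP V A : linear_subspace V ->
  V (orthoproj V A) /\
  forall B, V B -> frob_inner (A - orthoproj V A) B = 0.
Proof. by move=> /(exists_orthogonal_projection A)/(xgetPex 0). Qed.

Lemma frob_inner_orthoproj V A B : linear_subspace V -> V B ->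
  frob_inner (orthoproj V A) B = frob_inner A B.
Proof.
move=> lV VB; have [_ /(_ _ VB)] := orthoprojP A lV.
by rewrite frob_innerDl frob_innerNl => /eqP; rewrite subr_eq0 => /eqP.
Qed.

Lemma frob_norm_orthoproj V A : linear_subspace V ->
  frob_norm (orthoproj V A) <= frob_norm A.
Proof.
move=> lV; have [VP _] := orthoprojP A lV; set P := orthoproj V A.
have [->|P0] := eqVneq (frob_norm P) 0; first exact: frob_norm_ge0.
have {}P0 : 0 < frob_norm P by rewrite lt0r P0 frob_norm_ge0.
rewrite -(ler_pM2r P0) -expr2 sqr_frob_norm frob_inner_orthoproj//.
exact: le_trans (ler_norm _) (frob_cauchy_schwarz _ _).
Qed.

End Projection.

(** * Derivatives of matrix-valued functions *)

Section MatrixDerivatives.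
Context {R : realType}.
Implicit Types t : R.

Lemma is_derive_mxP m p (M : R -> 'M[R]_(m, p)) t dM :
  is_derive t 1 M dM <->
  forall i j, is_derive t 1 (fun x => M x i j) (dM i j).
Proof.
split=> [[dMt eM] i j|H].
  apply: DeriveDef; first by have /derivable_mxP := dMt; exact.
  by rewrite -eM derive_mx// mxE.
have dMt : derivable M t 1.
  by apply/derivable_mxP => i j; have [] := H i j.
apply: DeriveDef => //; rewrite derive_mx//; apply/matrixP => i j.
by rewrite mxE; have [] := H i j.
Qed.

Lemma is_derive_mulmx m p q (M : R -> 'M[R]_(m, p)) (N : R -> 'M[R]_(p, q))
    t dM dN :
  is_derive t 1 M dM -> is_derive t 1 N dN ->
  is_derive t 1 (fun x => M x *m N x) (dM *m N t + M t *m dN).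
Proof.
move=> /is_derive_mxP HM /is_derive_mxP HN; apply/is_derive_mxP => i j.
rewrite (_ : (fun x => _) = \sum_(k < p) ((M ^~ i) ^~ k * (N ^~ k) ^~ j)); last first.
  by apply/funext => x; rewrite mxE fct_sumE.
apply: is_derive_eq.
rewrite !mxE -big_split/=; apply: eq_bigr => k _.
by rewrite addrC /GRing.scale/= (mulrC (N t k j)).
Qed.

Lemma is_derive_trmx m p (M : R -> 'M[R]_(m, p)) t dM :
  is_derive t 1 M dM -> is_derive t 1 (fun x => (M x)^T) dM^T.
Proof.
move=> /is_derive_mxP HM; apply/is_derive_mxP => i j.
rewrite (_ : (fun x => _) = fun x => M x j i); first by rewrite mxE.
by apply/funext => x; rewrite mxE.
Qed.

Lemma is_derive_frob_inner n (X Y : R -> 'M[R]_n) t dX dY :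
  is_derive t 1 X dX -> is_derive t 1 Y dY ->
  is_derive t 1 (fun x => frob_inner (X x) (Y x))
    (frob_inner dX (Y t) + frob_inner (X t) dY).
Proof.
move=> HX HY; have := is_derive_mulmx (is_derive_trmx HX) HY.
move=> /is_derive_mxP H; rewrite /frob_inner.
rewrite (_ : (fun x => _) = \sum_(i < n) (fun x => ((X x)^T *m Y x) i i)); last first.
  by apply/funext => x; rewrite fct_sumE.
apply: is_derive_eq.
by rewrite -mxtraceD.
Qed.

Lemma is_derive_mulmxl m p q (A : 'M[R]_(m, p)) (N : R -> 'M[R]_(p, q)) t dN :
  is_derive t 1 N dN -> is_derive t 1 (fun x => A *m N x) (A *m dN).
Proof.
move=> HN; have := is_derive_mulmx (is_derive_cst A t 1) HN.
by rewrite mul0mx add0r.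
Qed.

Lemma is_derive_mx_scaled m p (M : R -> 'M[R]_(m, p)) r t dM :
  is_derive (r * t) 1 M dM -> is_derive t 1 (fun x => M (r * x)) (r *: dM).
Proof.
move=> /is_derive_mxP HM; apply/is_derive_mxP => i j.
have Hr : is_derive t 1 ( *%R r : R -> R) r.
  rewrite (_ : *%R r = r \*: (@id R)); last by apply/funext.
  by apply: is_derive_eq; rewrite [LHS]mulr1.
rewrite mxE mulrC.
exact: (@is_derive1_comp R (fun x => M x i j) ( *%R r)).
Qed.

End MatrixDerivatives.

(** * The Lie algebra is a linear subspace *)

Section SmoothCurves.
Context {R : realType} {n : nat}.
Implicit Types (f g : R -> 'M[R]_n) (t r e : R).

(** Recursion on the derivative, rather than on the order of derivation, lets
    the Leibniz rule be proved by induction on [k] for all pairs of curves. *)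
Fixpoint nderivable e k f : Prop :=
  if k is k'.+1 then
    (forall t, `|t| < e -> derivable f t 1) /\ nderivable e k' (derive1 f)
  else True.

Lemma nderivableP e f :
  (forall t, `|t| < e -> forall k, derivable (derive1n k f) t 1) <->
  forall k, nderivable e k f.
Proof.
split=> [H k|H t te k].
  elim: k f H => //= k IH f H; split=> [t te|]; first exact: (H t te 0%N).
  by apply: IH => t te j; have := H t te j.+1; rewrite /derive1n iterSr.
elim: k f H => [|k IH] f H; first by have [+ _] := H 1%N; exact.
by rewrite /derive1n iterSr; apply: IH => j; have [] := H j.+1.
Qed.

Lemma near_ball0 e t (P : R -> Prop) : `|t| < e ->
  (forall s, `|s| < e -> P s) -> \forall s \near t, P s.
Proof.
move=> te H; near=> s; apply: H; near: s.
have := @open_comp _ _ (fun x : R => `|x|) [set x | x < e].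
move=> /(_ (fun x _ => @norm_continuous _ R x) (@open_lt _ e)); rewrite openE.
exact.
Unshelve. all: by end_near. Qed.

(** Curves are only controlled on the interval, whereas [derive1] is a total
    function; derivatives agree on the interval because it is open. *)
Lemma nderivable_ext e k f g : (forall t, `|t| < e -> f t = g t) ->
  nderivable e k f -> nderivable e k g.
Proof.
elim: k f g => //= k IH f g fg [df dk]; split=> [t te|].
  by apply: near_eq_derivable (df t te); exact: near_ball0 te fg.
apply: IH dk => t te; rewrite !derive1E.
by apply: near_eq_derive; exact: near_ball0 te fg.
Qed.

Lemma nderivable_weak e e' k f :
  e' <= e -> nderivable e k f -> nderivable e' k f.
Proof.
move=> e'e; elim: k f => //= k IH f [df dk]; split; last exact: IH.
by move=> t te; apply: df; exact: lt_le_trans te e'e.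
Qed.

Lemma nderivableW e k f : nderivable e k.+1 f -> nderivable e k f.
Proof. by elim: k f => //= k IH f [df dk]; split=> //; exact: IH. Qed.

Lemma nderivable_cst e k (A : 'M[R]_n) : nderivable e k (fun=> A).
Proof.
elim: k A => //= k IH A; split=> [t _|]; first exact: derivable_cst.
apply: (nderivable_ext _ (IH 0)) => t _.
by rewrite derive1E derive_cst.
Qed.

Lemma nderivableD e k f g : nderivable e k f -> nderivable e k g ->
  nderivable e k (fun x => f x + g x).
Proof.
elim: k f g => //= k IH f g [df dfk] [dg dgk]; split=> [t te|].
  by apply: derivableD; [exact: df|exact: dg].
apply: nderivable_ext (IH _ _ dfk dgk) => t te /=.
by rewrite !derive1E deriveD//; [exact: df|exact: dg].
Qed.

Lemma is_derive_derive1 f t : derivable f t 1 -> is_derive t 1 f (derive1 f t).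
Proof. by move=> df; apply: DeriveDef => //; rewrite derive1E. Qed.

Lemma is_derive_derive1E f t df : is_derive t 1 f df -> derive1 f t = df.
Proof. by move=> fdf; rewrite derive1E derive_val. Qed.

Lemma nderivable_mulmx e k f g : nderivable e k f -> nderivable e k g ->
  nderivable e k (fun x => f x *m g x).
Proof.
elim: k f g => //= k IH f g [df dfk] [dg dgk].
have dfg t : `|t| < e -> is_derive t 1 (fun x => f x *m g x)
    (derive1 f t *m g t + f t *m derive1 g t).
  by move=> te; apply: is_derive_mulmx; apply: is_derive_derive1;
    [exact: df|exact: dg].
split=> [t /dfg[]//|].
have fk : nderivable e k f by exact: nderivableW.
have gk : nderivable e k g by exact: nderivableW.
apply: nderivable_ext (nderivableD (IH _ _ dfk gk) (IH _ _ fk dgk)) => t te.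
by rewrite (is_derive_derive1E (dfg t te)).
Qed.

Lemma nderivable_scaled e e' k r f : `|r| * e' < e -> nderivable e k f ->
  nderivable e' k (fun x => f (r * x)).
Proof.
move=> re; elim: k f => //= k IH f [df dk].
have rt t : `|t| < e' -> `|r * t| < e.
  move=> te; rewrite normrM; apply: le_lt_trans re.
  by rewrite ler_wpM2l// ltW.
have dfr t : `|t| < e' ->
    is_derive t 1 (fun x => f (r * x)) (r *: derive1 f (r * t)).
  by move=> te; apply/is_derive_mx_scaled/is_derive_derive1/df/rt.
split=> [t /dfr[]//|].
apply: nderivable_ext (nderivable_mulmx (nderivable_cst e' k r%:M) (IH _ dk)).
by move=> t te; rewrite mul_scalar_mx (is_derive_derive1E (dfr t te)).
Qed.

End SmoothCurves.

(** Addition of velocities is realised by the product of curves, and scaling by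
    a linear change of time. *)
Lemma lie_algebra_subspace (R : realType) (n : nat) (G : set 'M[R]_n) :
  matrix_lie_group G -> linear_subspace (lie_algebra G).
Proof.
move=> [_ G1 Gmul _ _]; split.
- exists (fun=> 1%:M), 1; split => //.
    move=> t t1; split => //.
    by move: t t1; apply/nderivableP => k; exact: nderivable_cst.
  by rewrite derive1E derive_cst.
- move=> A B [c [e [e0 c0 cG cA]]] [d [e' [e'0 d0 dG dB]]].
  pose m := Num.min e e'.
  have me : m <= e by rewrite ge_min lexx.
  have me' : m <= e' by rewrite ge_min lexx orbT.
  have m0 : 0 < m by rewrite lt_min e0.
  have cS := (nderivableP e c).1 (fun t te => (cG t te).2).
  have dS := (nderivableP e' d).1 (fun t te => (dG t te).2).
  exists (fun t => c t *m d t), m; split => //.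
  + by rewrite c0 d0 mulmx1.
  + move=> t tm; split.
      apply: Gmul; [have [] := cG t (lt_le_trans tm me) => //|].
      by have [] := dG t (lt_le_trans tm me').
    move: t tm; apply/nderivableP => k; apply: nderivable_mulmx.
      exact: nderivable_weak me (cS k).
    exact: nderivable_weak me' (dS k).
  + have c0' : derivable c 0 1.
      by have [_ /(_ 0%N)] := cG 0 (eq_ind_r (fun x => x < e) e0 (normr0 _)).
    have d0' : derivable d 0 1.
      by have [_ /(_ 0%N)] := dG 0 (eq_ind_r (fun x => x < e') e'0 (normr0 _)).
    have H := is_derive_mulmx (is_derive_derive1 c0') (is_derive_derive1 d0').
    by rewrite (is_derive_derive1E H) c0 d0 mulmx1 mul1mx cA dB.
- move=> r A [c [e [e0 c0 cG cA]]].
  have cS := (nderivableP e c).1 (fun t te => (cG t te).2).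
  have r1 : 0 < `|r| + 1 by have := normr_ge0 r; lra.
  pose m := e / (`|r| + 1).
  have m0 : 0 < m by rewrite divr_gt0.
  have rm : `|r| * m < e.
    rewrite /m mulrCA gtr_pMr// ltr_pdivrMr// mul1r; lra.
  exists (fun t => c (r * t)), m; split => //.
  + by rewrite mulr0.
  + move=> t tm; split.
      have rt : `|r * t| < e.
        by rewrite normrM (le_lt_trans _ rm)// ler_wpM2l// ltW.
      by have [] := cG _ rt.
    move: t tm; apply/nderivableP => k.
    exact: nderivable_scaled (cS k).
  + have c0' : derivable c (r * 0) 1.
      rewrite mulr0.
      by have [_ /(_ 0%N)] := cG 0 (eq_ind_r (fun x => x < e) e0 (normr0 _)).
    have H := is_derive_mx_scaled (is_derive_derive1 c0').
    by rewrite (is_derive_derive1E H) mulr0 cA.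
Qed.

(** * Differential inequalities on the half-line *)

(** Continuing [f] to negative times by its tangent at [0] turns the one-sided
    derivative at [0] into a two-sided one. *)
Lemma halfline_extension (R : realType) n (f df : R -> 'M[R]_n) :
  deriv_halfline f df -> exists h : R -> 'M[R]_n,
    (forall t : R, 0 <= t -> h t = f t) /\
    forall t : R, 0 <= t -> is_derive t 1 h (df t).
Proof.
move=> fdf; pose h s := if 0 <= s then f s else f 0 + s *: df 0.
have hf (t : R) : 0 <= t -> h t = f t by rewrite /h => ->.
exists h; split => // t t0.
suff H : (k^-1 *: (h (k *: 1 + t) - h t)) @[k --> 0^'] --> df t.
  apply: DeriveDef; first by apply/cvg_ex; exists (df t).
  exact: cvg_lim H.
apply/cvgrPdist_le => eps eps0.
have /cvgrPdist_le/(_ _ eps0) := fdf t t0.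
rewrite near_withinE => /nbhs_ballP[d /= d0 fd].
have [c c0 Hc] : exists2 c, 0 < c & forall k, `|k| < c -> k + t < 0 -> t = 0.
  have [->|tn0] := eqVneq t 0; first by exists 1.
  exists t; first by rewrite lt0r tn0.
  by move=> k; rewrite ltr_norml => /andP[+ _]; lra.
apply/nbhs_ballP; exists (Num.min d c); first by rewrite /= lt_min d0.
move=> k; rewrite /ball/= sub0r normrN lt_min => /andP[kd kc] k0.
rewrite [k *: 1]mulr1 (hf t t0).
have [kt|kt] := leP 0 (k + t).
  rewrite hf//; have kE : k = k + t - t by rewrite addrK.
  rewrite [X in X^-1]kE.
  apply: fd => //=; last by rewrite in_itv/= kt.
    by rewrite /ball/= opprD addrC subrK normrN.
  by rewrite -subr_eq0 addrK.
have t00 := Hc k kc kt; rewrite t00 addr0 in kt *.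
by rewrite /h (leNgt 0) kt/= [f 0 + _]addrC addrK scalerA mulVf// scale1r subrr normr0 ltW.
Qed.

(** The function [W t * expR (l * t)] has a nonpositive derivative. *)
Lemma exponential_decay (R : realType) (W dW : R -> R) (l : R) :
  (forall t : R, 0 <= t -> is_derive t 1 W (dW t)) ->
  (forall t : R, 0 <= t -> dW t <= - (l * W t)) ->
  forall t : R, 0 <= t -> W t <= W 0 * expR (- (l * t)).
Proof.
move=> WdW dWle t t0.
pose u s := W s * expR (l * s); pose du s := (dW s + l * W s) * expR (l * s).
have udu (s : R) : 0 <= s -> is_derive s 1 u (du s).
  move=> /WdW Ws.
  have Hl : is_derive s 1 ( *%R l : R -> R) l.
    rewrite (_ : *%R l = l \*: (@id R)); last by apply/funext.
    by apply: is_derive_eq; rewrite [LHS]mulr1.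
  have He : is_derive s 1 (fun x => expR (l * x)) (expR (l * s) * l).
    exact: (@is_derive1_comp R expR ( *%R l)).
  rewrite (_ : u = W * (fun x => expR (l * x))); last by apply/funext.
  by apply: is_derive_eq; rewrite /du /GRing.scale/=; ring.
have [c + uc] : exists2 c, c \in `[0, t] & u t - u 0 = du c * (t - 0).
  apply: MVT_segment => // [x|]; first by rewrite in_itv/= => /andP[/ltW/udu].
  apply: derivable_within_continuous => x; rewrite in_itv/= => /andP[/udu + _].
  by case.
rewrite in_itv/= => /andP[c0 _].
have duc : du c * (t - 0) <= 0.
  rewrite subr0 mulr_le0_ge0// mulr_le0_ge0 ?expR_ge0//.
  by have := dWle c c0; lra.
have : u t <= u 0 by rewrite -subr_le0 uc.
rewrite /u mulr0 expR0 mulr1 expRN => ut.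
by rewrite -ler_pdivrMr ?invr_gt0 ?expR_gt0// invrK.
Qed.

(** * The Lyapunov function of the observer *)

(** Here [p], [q], [x] stand for [|E|], [|e|] and [<E, A e>]. For [eps] small,
    [eps * x] is dominated by half of the definite form
    [p ^+ 2 / 2 + q ^+ 2 / (2 * kI)], and the terms in [eps * p ^+ 2] by half of
    [k * p ^+ 2]. *)
Lemma lyapunov_constants (R : realType) (k kI M c1 c2 al : R) :
  0 < k -> 0 < kI -> 0 <= M -> 0 <= c2 -> 0 < al ->
  exists eps m K l : R, [/\ 0 < eps, 0 < m, 0 < K, 0 < l &
    forall p q x : R, `|x| <= M * p * q ->
    [/\ m * (p ^+ 2 + q ^+ 2) <=
          p ^+ 2 / 2 + q ^+ 2 / (2 * kI) + eps * x,
        p ^+ 2 / 2 + q ^+ 2 / (2 * kI) + eps * x <=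
          K * (p ^+ 2 + q ^+ 2) &
        - (k * p ^+ 2) + eps * (c1 * p * q - al * q ^+ 2 + c2 * p ^+ 2) <=
          - (l * (p ^+ 2 + q ^+ 2))]].
Proof.
move=> k0 kI0 M0 c20 al0.
pose h := (2 * kI)^-1; have h0 : 0 < h by rewrite invr_gt0 mulr_gt0.
pose m := Num.min (1 / 4) (h / 2).
have m0 : 0 < m by rewrite lt_min; apply/andP; split; lra.
have m4 : m <= 1 / 4 by rewrite ge_min lexx.
have mh : m <= h / 2 by rewrite ge_min lexx orbT.
(* Completing the square bounds [c1 p q + c2 p^2] by [D p^2] and half of
   [al q^2]. *)
pose D := c2 + c1 ^+ 2 / (2 * al).
have D0 : 0 <= D by rewrite addr_ge0// divr_ge0 ?sqr_ge0// mulr_ge0// ltW.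
have cross p q : c1 * p * q + c2 * p ^+ 2 <= D * p ^+ 2 + al / 2 * q ^+ 2.
  have : 0 <= (c1 * p - al * q) ^+ 2 / (2 * al).
    by rewrite divr_ge0 ?sqr_ge0// mulr_ge0// ltW.
  suff -> : (c1 * p - al * q) ^+ 2 / (2 * al) =
    D * p ^+ 2 + al / 2 * q ^+ 2 - (c1 * p * q + c2 * p ^+ 2) by lra.
  by rewrite /D; field; rewrite gt_eqF.
pose eps := Num.min (2 * m / (M + 1)) (k / 2 / (D + 1)).
have M1 : 0 < M + 1 by lra.
have D1 : 0 < D + 1 by lra.
have eps0 : 0 < eps by rewrite lt_min !divr_gt0// mulr_gt0.
have epsM : eps * M <= 2 * m.
  have : eps * (M + 1) <= 2 * m by rewrite -ler_pdivlMr// ge_min lexx.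
  by nra.
have epsD : eps * D <= k / 2.
  have : eps * (D + 1) <= k / 2 by rewrite -ler_pdivlMr// ge_min lexx orbT.
  by nra.
pose l := Num.min (k / 2) (eps * al / 2).
have l0 : 0 < l by rewrite lt_min !divr_gt0// mulr_gt0.
have lk : l <= k / 2 by rewrite ge_min lexx.
have la : l <= eps * al / 2 by rewrite ge_min lexx orbT.
exists eps, m, (1 / 2 + h + m), l; split => //; first lra.
move=> p q x; rewrite -/h => xM.
have p2 : 0 <= p ^+ 2 by exact: sqr_ge0.
have q2 : 0 <= q ^+ 2 by exact: sqr_ge0.
have epsx : `|eps * x| <= m * (p ^+ 2 + q ^+ 2).
  rewrite normrM gtr0_norm//.
  apply: (@le_trans _ _ (eps * (M * ((p ^+ 2 + q ^+ 2) / 2)))).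
    rewrite ler_pM2l//; apply: le_trans xM _.
    rewrite -mulrA ler_wpM2l//; have := sqr_ge0 (p - q); nra.
  have S0 : 0 <= (p ^+ 2 + q ^+ 2) / 2 by lra.
  have := ler_wpM2r S0 epsM; lra.
move: epsx; rewrite ler_norml => /andP[lo up].
clearbody h m D eps l.
split.
- have := ler_wpM2r p2 m4; have := ler_wpM2r q2 mh; lra.
- have := mulr_ge0 (ltW h0) p2; lra.
- have := cross p q; rewrite -(ler_pM2l eps0) => cr.
  have := ler_wpM2r p2 epsD.
  have := ler_wpM2r p2 lk; have := ler_wpM2r q2 la.
  lra.
Qed.

(** The left-hand side is the derivative of the Lyapunov function. The terms
    [<E, A e>] of its first two summands cancel because [<P, e> = <A^T E, e>];
    the third summand contributes [- |A e|^2], and everything else is estimated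
    by the Cauchy-Schwarz inequality. *)
Lemma lyapunov_dissipation (R : realType) n (E e A xi b P dE : 'M[R]_n)
    (kP kI eps Bxi Bb M al : R) :
  0 < kI -> 0 <= kP -> 0 <= eps -> 0 <= M ->
  frob_norm xi <= Bxi -> frob_norm b <= Bb -> frob_norm A <= M ->
  al * frob_inner e e <= frob_inner (A *m e) (A *m e) ->
  frob_inner P e = frob_inner (A^T *m E) e ->
  frob_norm P <= frob_norm (A^T *m E) ->
  dE = E *m (xi + b) - A *m e - kP *: E ->
  frob_inner E dE + frob_inner e (kI *: P) / kI +
    eps * (frob_inner dE (A *m e) +
           frob_inner E (A *m xi *m e + A *m (kI *: P))) <=
  - ((kP - (Bxi + Bb)) * frob_norm E ^+ 2) +
    eps * ((Bxi + Bb + kP + Bxi) * M * frob_norm E * frob_norm e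
           - al * frob_norm e ^+ 2 + kI * M ^+ 2 * frob_norm E ^+ 2).
Proof.
move=> kI0 kP0 eps0 M0 xiB bB AM alA Pe PE ->.
set p := frob_norm E; set q := frob_norm e.
have p0 : 0 <= p by exact: frob_norm_ge0.
have q0 : 0 <= q by exact: frob_norm_ge0.
have Bxi0 : 0 <= Bxi := le_trans (frob_norm_ge0 _) xiB.
have Bb0 : 0 <= Bb := le_trans (frob_norm_ge0 _) bB.
have xbB : frob_norm (xi + b) <= Bxi + Bb.
  by apply: le_trans (frob_normD _ _) _; exact: lerD.
have inner_le X Y c d : frob_norm X <= c -> frob_norm Y <= d ->
    frob_inner X Y <= c * d.
  move=> Xc Yd; apply: le_trans (ler_norm _) _.
  apply: le_trans (frob_cauchy_schwarz _ _) _.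
  by rewrite ler_pM ?frob_norm_ge0.
have mul_le (X Y : 'M[R]_n) c d : frob_norm X <= c -> frob_norm Y <= d ->
    frob_norm (X *m Y) <= c * d.
  move=> Xc Yd; apply: le_trans (frob_norm_mulmx _ _) _.
  by rewrite ler_pM ?frob_norm_ge0.
have t1 : frob_inner E (E *m (xi + b)) <= p * (p * (Bxi + Bb)).
  by apply: inner_le => //; apply: mul_le.
have t2 : frob_inner (E *m (xi + b)) (A *m e) <= p * (Bxi + Bb) * (M * q).
  by apply: inner_le; apply: mul_le.
have t3 : - frob_inner E (A *m e) <= p * (M * q).
  rewrite -frob_innerNl; apply: inner_le; last exact: mul_le.
  by rewrite -scaleN1r frob_normZ normrN1 mul1r.
have t4 : frob_inner E (A *m xi *m e) <= p * (M * Bxi * q).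
  have AxiB : frob_norm (A *m xi) <= M * Bxi by apply: mul_le.
  by apply: inner_le => //; apply: mul_le.
have t5 : frob_inner E (A *m P) <= p * (M * (M * p)).
  have AE : frob_norm (A^T *m E) <= M * p.
    by apply: mul_le => //; rewrite frob_norm_trmx.
  by apply: inner_le => //; apply: mul_le => //; apply: le_trans PE _.
have t6 : frob_inner E (A *m e) = frob_inner e P.
  by rewrite frob_inner_adj -Pe frob_innerC.
have EE : frob_inner E E = p ^+ 2 by rewrite -sqr_frob_norm.
have AeAe : frob_inner (A *m e) (A *m e) >= al * q ^+ 2.
  by rewrite sqr_frob_norm.
have u3 := ler_wpM2l kP0 t3.
have u5 := ler_wpM2l (ltW kI0) t5.
rewrite -scalemxAr.
apply: lerD; last apply: ler_wpM2l => //.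
  rewrite !(frob_innerDr, frob_innerNr, frob_innerZr) EE t6.
  rewrite [kI * _ / kI]mulrAC divff ?gt_eqF// mul1r.
  move: t1; clear; lra.
rewrite !(frob_innerDl, frob_innerNl, frob_innerZl) frob_innerDr frob_innerZr.
move: t2 u3 t4 u5 AeAe; clear; lra.
Qed.


Lemma sum_le_of_sqr_le (R : realType) (p q p0 q0 r x : R) :
  0 <= p -> 0 <= q -> 0 <= p0 -> 0 <= q0 -> 0 <= r -> 0 <= x ->
  p ^+ 2 + q ^+ 2 <= r * (p0 ^+ 2 + q0 ^+ 2) * x ^+ 2 ->
  p + q <= Num.sqrt (2 * r) * (p0 + q0) * x.
Proof.
move=> p_ge0 q_ge0 p0_ge0 q0_ge0 r0 x0 h.
have s0 : 0 <= p0 + q0 by exact: addr_ge0.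
rewrite -(@ler_pXn2r _ 2)// ?nnegrE ?addr_ge0 ?mulr_ge0 ?sqrtr_ge0//.
rewrite !exprMn sqr_sqrtr ?mulr_ge0//.
have : r * (p0 ^+ 2 + q0 ^+ 2) * x ^+ 2 <= r * (p0 + q0) ^+ 2 * x ^+ 2.
  rewrite ler_wpM2r ?sqr_ge0// ler_wpM2l//.
  by have := mulr_ge0 p0_ge0 q0_ge0; nra.
have := sqr_ge0 (p - q); nra.
Qed.

Lemma is_derive_lincomb3 (R : realType) (f1 f2 f3 : R -> R)
    (c1 c2 c3 t d1 d2 d3 : R) :
  is_derive t 1 f1 d1 -> is_derive t 1 f2 d2 -> is_derive t 1 f3 d3 ->
  is_derive t 1 (fun x => c1 * f1 x + c2 * f2 x + c3 * f3 x)
    (c1 * d1 + c2 * d2 + c3 * d3).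
Proof.
move=> df1 df2 df3.
exact: (is_deriveD (is_deriveD (is_deriveZ c1 df1) (is_deriveZ c2 df2))
  (is_deriveZ c3 df3)).
Qed.

(** The measurement bias [b] enters through [A *m b], which combines with
    [A *m bbar] into the bias error. *)
Lemma observer_error_rate (R : realType) n (A Abar xi b bbar : 'M[R]_n)
    (k : R) :
  A *m xi - (Abar *m (xi + b) - A *m bbar + k *: (A - Abar)) =
  (A - Abar) *m (xi + b) - A *m (b - bbar) - k *: (A - Abar).
Proof.
rewrite mulmxBl mulmxBr (mulmxDr A).
set x1 := A *m xi; set x2 := Abar *m _; set x3 := A *m bbar; set x4 := A *m b.
by apply/matrixP => i j; rewrite !mxE; ring.
Qed.

(** The invertible factor [F] is compensated by the norm of its inverse; the
    added 1 avoids having to know that this norm is not zero. *)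
Lemma frob_inner_mulmx_ge (R : realType) n (F g X : 'M[R]_n) (L : R) :
  (0 < n)%N -> F \in unitmx -> 0 <= L -> L <= sigma_min g ->
  L ^+ 2 / (frob_norm (invmx F) ^+ 2 + 1) * frob_inner X X <=
  frob_inner (F *m g *m X) (F *m g *m X).
Proof.
move=> n0 F_unit L0 Lg; set f := frob_norm (invmx F).
have f1 : 0 < f ^+ 2 + 1 by have := sqr_ge0 f; lra.
have LX : L ^+ 2 * frob_inner X X <= frob_norm (g *m X) ^+ 2.
  rewrite sqr_frob_norm; apply: le_trans (sigma_min_frob _ n0 (le_trans L0 Lg)).
  by rewrite ler_wpM2r ?frob_inner_ge0// ler_pXn2r ?nnegrE// (le_trans L0 Lg).
have gX : frob_norm (g *m X) <= f * frob_norm (F *m g *m X).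
  rewrite -mulmxA -{1}(mulKmx F_unit (g *m X)).
  exact: frob_norm_mulmx.
rewrite mulrAC ler_pdivrMr// -(sqr_frob_norm (F *m g *m X)); apply: le_trans LX _.
have gX2 : frob_norm (g *m X) ^+ 2 <= (f * frob_norm (F *m g *m X)) ^+ 2.
  by rewrite ler_pXn2r ?nnegrE ?mulr_ge0 ?frob_norm_ge0.
apply: le_trans gX2 _; rewrite exprMn.
by have := sqr_ge0 (frob_norm (F *m g *m X)); lra.
Qed.

Lemma frob_norm_sigma_max (R : realType) n (g : 'M[R]_n) (U : R) :
  (0 < n)%N -> 0 <= sigma_max g -> sigma_max g <= U ->
  frob_norm g <= U * frob_norm (1%:M : 'M[R]_n).
Proof.
move=> n0 s0 sU; have U0 := le_trans s0 sU.
apply: ler_frob_norm; first by rewrite mulr_ge0 ?frob_norm_ge0.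
rewrite exprMn sqr_frob_norm -{1 2}(mulmx1 g).
apply: le_trans (sigma_max_frob _ _ n0) _.
by rewrite ler_wpM2r ?frob_inner_ge0// ler_pXn2r ?nnegrE.
Qed.

(** * Exponential convergence *)

Theorem mainTheorem1 (R : realType) (n : nat) (n_gt0 : (0 < n)%N)
    (G : set 'M[R]_n) (G_lie : matrix_lie_group G)
    (g xi : R -> 'M[R]_n)
    (g_in : forall t : R, 0 <= t -> G (g t))
    (xi_in : forall t : R, 0 <= t -> lie_algebra G (xi t))
    (g_ode : deriv_halfline g (fun t => g t *m xi t))
    (F : 'M[R]_n) (F_unit : F \in unitmx)
    (A : R -> 'M[R]_n) (A_def : forall t : R, 0 <= t -> A t = F *m g t)
    (b : 'M[R]_n) (b_in : lie_algebra G b)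
    (xi_m : R -> 'M[R]_n) (xi_m_def : forall t : R, 0 <= t -> xi_m t = xi t + b)
    (B_xi B_b : R) (B_xi_gt0 : 0 < B_xi) (B_b_gt0 : 0 < B_b)
    (xi_bounded : forall t : R, 0 <= t -> frob_norm (xi t) <= B_xi)
    (b_bounded : frob_norm b <= B_b)
    (L_g U_g : R) (L_g_gt0 : 0 < L_g) (U_g_gt0 : 0 < U_g)
    (g_bounded : forall t : R, 0 <= t ->
      [/\ L_g <= sigma_min (g t), sigma_min (g t) <= sigma_max (g t)
        & sigma_max (g t) <= U_g])
    (k_P k_I : R) (k_P_gt : B_xi + B_b < k_P) (k_I_gt0 : 0 < k_I) :
  exists a C : R, [/\ 0 < a, 0 < C &
    forall Abar bbar : R -> 'M[R]_n,
      (forall t : R, 0 <= t -> lie_algebra G (bbar t)) ->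
      deriv_halfline Abar
        (fun t => Abar t *m xi_m t - A t *m bbar t + k_P *: (A t - Abar t)) ->
      deriv_halfline bbar
        (fun t => - (k_I *: orthoproj (lie_algebra G)
                              ((A t)^T *m (A t - Abar t)))) ->
      forall t : R, 0 <= t ->
        frob_norm (A t - Abar t) + frob_norm (b - bbar t) <=
        C * (frob_norm (A 0 - Abar 0) + frob_norm (b - bbar 0))
          * expR (- (a * t))].
Proof.
have gsub := lie_algebra_subspace G_lie.
pose M := frob_norm F * (U_g * frob_norm (1%:M : 'M[R]_n)).
pose al := L_g ^+ 2 / (frob_norm (invmx F) ^+ 2 + 1).
have M0 : 0 <= M by rewrite !mulr_ge0 ?frob_norm_ge0// ltW.
have al0 : 0 < al.
  by rewrite divr_gt0 ?exprn_gt0// ltr_wpDl ?sqr_ge0.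
have AM (t : R) : 0 <= t -> frob_norm (A t) <= M.
  move=> t0; have [Lg gLU gU] := g_bounded t t0; rewrite A_def//.
  apply: le_trans (frob_norm_mulmx _ _) _; rewrite ler_wpM2l ?frob_norm_ge0//.
  apply: frob_norm_sigma_max => //.
  by rewrite (le_trans _ gLU)// (le_trans (ltW L_g_gt0) Lg).
have Aal (t : R) (X : 'M[R]_n) : 0 <= t ->
    al * frob_inner X X <= frob_inner (A t *m X) (A t *m X).
  move=> t0; have [Lg _ _] := g_bounded t t0; rewrite A_def//.
  by apply: frob_inner_mulmx_ge => //; exact: ltW.
have k_gt0 : 0 < k_P - (B_xi + B_b) by rewrite subr_gt0.
have k_P_ge0 : 0 <= k_P by rewrite ltW// (lt_trans _ k_P_gt)// addr_gt0.
have [eps [m [K [l [eps0 m0 K0 l0 bounds]]]]] :=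
  lyapunov_constants ((B_xi + B_b + k_P + B_xi) * M) k_gt0 k_I_gt0 M0
    (mulr_ge0 (ltW k_I_gt0) (sqr_ge0 M)) al0.
exists (l / (2 * K)), (Num.sqrt (2 * (K / m))); split.
- by rewrite divr_gt0// mulr_gt0.
- by rewrite sqrtr_gt0 mulr_gt0// divr_gt0.
move=> Abar bbar bbar_in Abar_ode bbar_ode.
have [g' [g'E dg']] := halfline_extension g_ode.
have [Abar' [Abar'E dAbar']] := halfline_extension Abar_ode.
have [bbar' [bbar'E dbbar']] := halfline_extension bbar_ode.
(* The primed functions are the extensions to negative times; they agree with
   the unprimed ones on the half-line. *)
pose E (t : R) : 'M[R]_n := A t - Abar t.
pose e (t : R) : 'M[R]_n := b - bbar t.
pose E' (t : R) : 'M[R]_n := F *m g' t - Abar' t.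
pose e' (t : R) : 'M[R]_n := b - bbar' t.
have A'E (t : R) : 0 <= t -> F *m g' t = A t by move=> t0; rewrite g'E// A_def.
have E'E (t : R) : 0 <= t -> E' t = E t by move=> t0; rewrite /E' A'E// Abar'E.
have e'E (t : R) : 0 <= t -> e' t = e t by move=> t0; rewrite /e' bbar'E.
pose P (t : R) : 'M[R]_n := orthoproj (lie_algebra G) ((A t)^T *m E t).
pose dE (t : R) : 'M[R]_n := E t *m (xi t + b) - A t *m e t - k_P *: E t.
have dA' (t : R) : 0 <= t -> is_derive t 1 (fun x => F *m g' x) (A t *m xi t).
  by move=> t0; rewrite A_def// -mulmxA; apply/is_derive_mulmxl/dg'.
have dE' (t : R) : 0 <= t -> is_derive t 1 E' (dE t).
  move=> t0; have dAt := dA' t t0; have dAbart := dAbar' t t0.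
  rewrite /dE /E /e -observer_error_rate -xi_m_def//.
  exact: is_deriveB.
have de' (t : R) : 0 <= t -> is_derive t 1 e' (k_I *: P t).
  move=> t0; have dbt := dbbar' t t0.
  have := is_deriveB (is_derive_cst b t 1) dbt.
  by rewrite sub0r opprK.
pose f1 (t : R) : R := frob_inner (E' t) (E' t).
pose f2 (t : R) : R := frob_inner (e' t) (e' t).
pose f3 (t : R) : R := frob_inner (E' t) (F *m g' t *m e' t).
pose W (t : R) : R := 2^-1 * f1 t + (2 * k_I)^-1 * f2 t + eps * f3 t.
pose dW (t : R) : R := frob_inner (E t) (dE t) + frob_inner (e t) (k_I *: P t) / k_I +
  eps * (frob_inner (dE t) (A t *m e t) +
         frob_inner (E t) (A t *m xi t *m e t + A t *m (k_I *: P t))).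
have WdW (t : R) : 0 <= t -> is_derive t 1 W (dW t).
  move=> t0.
  have d1 := is_derive_frob_inner (dE' t t0) (dE' t t0).
  have d2 := is_derive_frob_inner (de' t t0) (de' t t0).
  have d3 := is_derive_frob_inner (dE' t t0)
    (is_derive_mulmx (dA' t t0) (de' t t0)).
  apply: (is_derive_eq (is_derive_lincomb3 _ _ _ d1 d2 d3)).
  rewrite E'E// e'E// A'E// /dW (frob_innerC (dE t) (E t)).
  rewrite (frob_innerC (k_I *: P t)).
  by field; rewrite gt_eqF.
have WE (t : R) : 0 <= t -> W t = frob_norm (E t) ^+ 2 / 2 +
    frob_norm (e t) ^+ 2 / (2 * k_I) + eps * frob_inner (E t) (A t *m e t).
  move=> t0; rewrite !sqr_frob_norm -E'E// -e'E// -A'E//.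
  by rewrite /W mulrC [_^-1 * f2 t]mulrC.
have bnd (t : R) : 0 <= t -> `|frob_inner (E t) (A t *m e t)| <=
    M * frob_norm (E t) * frob_norm (e t).
  move=> t0; apply: le_trans (frob_cauchy_schwarz _ _) _.
  rewrite [M * _]mulrC -mulrA ler_wpM2l ?frob_norm_ge0//.
  apply: le_trans (frob_norm_mulmx _ _) _.
  by rewrite ler_wpM2r ?frob_norm_ge0// AM.
pose s (t : R) : R := frob_norm (E t) ^+ 2 + frob_norm (e t) ^+ 2.
have Wlo (t : R) : 0 <= t -> m * s t <= W t.
  by move=> t0; have [h _ _] := bounds _ _ _ (bnd t t0); rewrite WE.
have Wup (t : R) : 0 <= t -> W t <= K * s t.
  by move=> t0; have [_ h _] := bounds _ _ _ (bnd t t0); rewrite WE.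
have Wdiss (t : R) : 0 <= t -> dW t <= - (l / K * W t).
  move=> t0; have [_ _ h] := bounds _ _ _ (bnd t t0).
  apply: (@le_trans _ _ (- (l * s t))); last first.
    rewrite lerN2 mulrAC ler_pdivrMr// -mulrA ler_pM2l// mulrC.
    exact: Wup.
  apply: le_trans _ h.
  have eV : lie_algebra G (e t).
    rewrite /e -scaleN1r; apply: (subspaceD gsub) => //.
    by apply: (subspaceZ gsub); exact: bbar_in.
  exact: (lyapunov_dissipation k_I_gt0 k_P_ge0 (ltW eps0) M0 (xi_bounded t t0)
    b_bounded (AM t t0) (Aal t _ t0) (frob_inner_orthoproj _ gsub eV)
    (frob_norm_orthoproj _ gsub) erefl).
move=> t t0.
apply: sum_le_of_sqr_le; rewrite ?frob_norm_ge0 ?expR_ge0//.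
  by rewrite divr_ge0// ltW.
have := exponential_decay WdW Wdiss t0.
have -> : expR (- (l / K * t)) = expR (- (l / (2 * K) * t)) ^+ 2.
  rewrite -expRM_natl; congr expR; field; rewrite gt_eqF//.
set x := expR _ => Wt.
have : m * s t <= K * s 0 * x ^+ 2.
  apply: le_trans (Wlo t t0) (le_trans Wt _).
  by rewrite ler_wpM2r ?sqr_ge0// Wup.
rewrite -ler_pdivlMl// => h; apply: (le_trans h).
suff -> : m^-1 * (K * s 0 * x ^+ 2) = K / m * s 0 * x ^+ 2 by [].
by field; rewrite gt_eqF.
Qed.
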